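(* Let $d\ge 2$ be an integer, and let $(\mathbf{X}_n)_{n\ge 0}$ be the $d$-dimensional Pólya random walk. Then state $\mathbf{0}=(0,\ldots,0)$ is transient.
   Context: Pólya–Eggenberger urn: an urn initially contains $w>0$ white balls and $b>0$ blue balls ($w,b$ integers). At each unit of discrete time a ball is drawn uniformly at random from the urn and is returned to the urn together with one additional ball of the same color. Let $W_n$ and $B_n$ be the numbers of white and blue draws among the first $n$ draws. One-dimensional Pólya random walk: a particle starts at the origin, $X_0=0$, and after each draw moves by $+1$ if the drawn ball is white and by $-1$ if it is blue, so $X_n=W_n-B_n\in\mathbb{Z}$. $d$-dimensional Pólya random walk: take $d$ independent one-dimensional Pólya random walks $X_n^{(1)},\ldots,X_n^{(d)}$, the $i$th being driven by its own Pólya–Eggenberger urn (with its own initial numbers $w_i\ge1$ of white and $b_i\ge 1$ of blue balls), and set $\mathbf{X}_n=(X_n^{(1)},\ldots,X_n^{(d)})$. Thus all coordinates change by $\pm1$ at each step. Recurrence: a state is recurrent if the particle's probability of returning to it infinitely often is $1$; a state that is not recurrent is transient. *)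

(* Defs.v *)
From HB Require Import structures.
From mathcomp Require Import all_boot all_order all_algebra.
From mathcomp Require Import all_classical all_reals all_analysis.

Set Implicit Arguments.
Unset Strict Implicit.
Unset Printing Implicit Defensive.

Import Order.TTheory GRing.Theory Num.Theory.

Local Open Scope classical_set_scope.
Local Open Scope ring_scope.

Record urn := Urn { white : nat; blue : nat }.

(* A draw is encoded by a boolean: [true] is white, [false] is blue.  The drawn
   ball goes back into the urn together with one more ball of its colour. *)
Definition replace (u : urn) (c : bool) : urn :=
  if c then Urn (white u).+1 (blue u) else Urn (white u) (blue u).+1.

Definition contents (u : urn) (s : seq bool) : urn := foldl replace u s.

Section Urn.
Context {dT : measure_display} {T : measurableType dT} {R : realType}.
Variable P : probability T R.

(* Meaningful only when [P B] is nonzero. *)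
Definition cond_prob (A B : set T) : R := fine (P (A `&` B)) / fine (P B).

(* [D k] is the (k+1)-st draw. *)
Definition draws (D : nat -> T -> bool) (n : nat) (t : T) : seq bool :=
  mkseq (fun k => D k t) n.

(* Given the colours of the first n draws, the next ball is uniform among the
   balls then in the urn. *)
Definition polya_draws (u : urn) (D : nat -> {RV P >-> bool}) : Prop :=
  forall (n : nat) (s : seq bool),
    let history := [set t | draws D n t = s] in
    let v := contents u s in
    P history != 0%E ->
    cond_prob [set t | D n t = true] history =
      (white v)%:R / (white v + blue v)%:R.

Definition white_draws (D : nat -> T -> bool) (n : nat) (t : T) : nat :=
  count_mem true (draws D n t).

Definition blue_draws (D : nat -> T -> bool) (n : nat) (t : T) : nat :=
  count_mem false (draws D n t).

Definition walk (D : nat -> T -> bool) (n : nat) (t : T) : int :=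
  (white_draws D n t)%:Z - (blue_draws D n t)%:Z.

Definition walk_vec (d : nat) (D : 'I_d -> nat -> T -> bool)
    (n : nat) (t : T) : 'rV[int]_d :=
  \row_i walk (D i) n t.

(* The singletons suffice as generators because the processes considered have
   a countable state space. *)
Definition sigma_process {S : countType} (X : nat -> T -> S) : set (set T) :=
  <<s [set A | exists n x, A = X n @^-1` [set x]] >>.

Definition independent_processes {I : finType} {S : countType}
    (X : I -> nat -> T -> S) : Prop :=
  forall (J : {set I}) (E : I -> set T),
    (forall i, i \in J -> sigma_process (X i) (E i)) ->
    P (\bigcap_(i in [set` J]) E i) = (\prod_(i in J) fine (P (E i)))%:E.

Definition recurrent {S : Type} (X : nat -> T -> S) (x : S) : Prop :=
  P (lim_sup_set (fun n => X n @^-1` [set x])) = 1%E.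

Definition transient {S : Type} (X : nat -> T -> S) (x : S) : Prop :=
  ~ recurrent X x.

End Urn.

(* Main.v *)
Require Import Defs.
From HB Require Import structures.
From mathcomp Require Import all_boot all_order all_algebra.
From mathcomp Require Import all_classical all_reals all_analysis.
From mathcomp Require Import zify ring lra.

Set Implicit Arguments.
Unset Strict Implicit.
Unset Printing Implicit Defensive.

Import Order.TTheory GRing.Theory Num.Theory.

Local Open Scope classical_set_scope.
Local Open Scope ring_scope.

(** The number of white draws has, up to time [n], a law that is spread out at
    scale [n]: no value is taken with probability more than [m / (m + n)], where
    [m] is one less than the initial number of balls (for an urn with one ball of
    each colour this is the uniform law on [0, n]).  Since the position of a
    one-dimensional walk at time [n] determines the number of white draws, the
    walk is at 0 at time [n] with probability [O(1/n)].  Two independent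
    coordinates are then simultaneously at 0 with probability [O(1/n^2)], which
    is summable, and Borel-Cantelli shows that the walk almost surely returns
    to 0 only finitely often.

    The bound [white_draws_ub] needs no asymptotics of binomial coefficients.
    Let [q n k] be the probability of [k] white draws among the first [n]; with
    [w] white and [b] blue balls initially, the urn rule gives
      [q n.+1 k = q n (k - 1) * (w + k - 1) / (w + b + n)
                  + q n k * (b + n - k) / (w + b + n)].
    The numerators add up to [w + b + n - 1 = m + n], free of [k], so a bound
    on [q n] uniform in [k], multiplied by [(m + n) / (m + n + 1)], bounds
    [q n.+1], and these factors telescope. *)

(** * Urn contents and histories *)

Lemma contents_count (u : urn) (s : seq bool) :
  contents u s = Urn (white u + count_mem true s) (blue u + count_mem false s).
Proof.
elim: s u => [|c s IHs] u /=; first by rewrite !addn0; case: u.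
by rewrite IHs; case: c => /=; congr Urn; lia.
Qed.

Lemma count_true_false (s : seq bool) :
  (count_mem true s + count_mem false s)%N = size s.
Proof. by elim: s => //= -[] s IHs /=; lia. Qed.

Section History.
Context {dT : measure_display} {T : measurableType dT} {R : realType}.
Variables (P : probability T R) (D : nat -> {RV P >-> bool}).

Lemma drawsS n t : draws D n.+1 t = rcons (draws D n t) (D n t).
Proof. exact: mkseqS. Qed.

Lemma measurable_draw n c : measurable [set t | D n t = c].
Proof. exact: (measurable_funPTI (D n) (Y := [set c])). Qed.

Lemma measurable_history n s : measurable [set t | draws D n t = s].
Proof.
elim: n s => [|n IHn] s.
  case: s => [|x s]; first by rewrite (_ : [set _ | _] = setT)//; apply/seteqP; split.
  by rewrite (_ : [set _ | _] = set0)//; apply/seteqP; split.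
case/lastP: s => [|s c].
  by rewrite (_ : [set _ | _] = set0)//; apply/seteqP; split.
rewrite (_ : [set _ | _] = [set t | draws D n t = s] `&` [set t | D n t = c]).
  by apply: measurableI; [exact: IHn|exact: measurable_draw].
apply/seteqP; split=> t; rewrite /mkset drawsS.
  by move=> /rcons_inj[].
by move=> [/= -> ->].
Qed.

Lemma history_event n (p : pred (seq bool)) :
  [set t | p (draws D n t)] =
  \bigcup_(s in [set s : n.-tuple bool | p s]) [set t | draws D n t = s].
Proof.
apply/seteqP; split=> [t /= pt|t [s /= ps ->]//].
by exists (Tuple (introT eqP (size_mkseq (fun k => D k t) n))).
Qed.

Lemma measurable_history_event n (p : pred (seq bool)) :
  measurable [set t | p (draws D n t)].
Proof.
rewrite history_event; apply: fin_bigcup_measurable => [|s _].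
  exact: finite_finset.
exact: measurable_history.
Qed.

(** The law of total probability over the histories: a conditional probability
    common to all histories satisfying [p] is also the conditional probability
    given [p].  The product form makes sense for null histories too. *)
Lemma probability_history_eventI n (p : pred (seq bool)) (A : set T) (c : R) :
  measurable A -> 0 <= c ->
  (forall s : n.-tuple bool, p s ->
    P ([set t | draws D n t = s] `&` A) = (c%:E * P [set t | draws D n t = s])%E) ->
  P ([set t | p (draws D n t)] `&` A) = (c%:E * P [set t | p (draws D n t)])%E.
Proof.
move=> mA c0 Hc; rewrite history_event setI_bigcupl.
rewrite !measure_fin_bigcup.
- rewrite ge0_mule_fsumr; last by move=> s; exact: measure_ge0.
  by apply: eq_fsbigr => s; rewrite inE /=; exact: Hc.
- exact: finite_finset.
- by move=> s s' _ _ [t /= [-> /val_inj]].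
- by move=> s _; exact: measurable_history.
- exact: finite_finset.
- by move=> s s' _ _ [t /= [[-> _] [/val_inj]]].
- by move=> s _; apply: measurableI => //; exact: measurable_history.
Qed.

Lemma white_drawsS n t : white_draws D n.+1 t = (white_draws D n t + D n t)%N.
Proof. by rewrite /white_draws drawsS -cats1 count_cat /= addn0 eqb_id. Qed.

Lemma white_draws_leq n t : (white_draws D n t <= n)%N.
Proof. by rewrite -[leqRHS](size_mkseq (fun k => D k t)) count_size. Qed.

Lemma white_draws_event n k : [set t | white_draws D n t = k] =
  [set t | pred1 k (count_mem true (draws D n t))].
Proof. by apply/seteqP; split=> t /= /eqP. Qed.

Lemma measurable_white_draws n k : measurable [set t | white_draws D n t = k].
Proof.
rewrite white_draws_event.
exact: (measurable_history_event n (fun s => pred1 k (count_mem true s))).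
Qed.

End History.

(** * Spread of the number of white draws *)

Section UrnBound.
Context {dT : measure_display} {T : measurableType dT} {R : realType}.
Variables (P : probability T R) (D : nat -> {RV P >-> bool}) (u : urn).
Hypothesis urnD : polya_draws u D.

(** The contents of the urn depend on the history only through the number of
    white draws, so the draw rule also holds conditionally on that number. *)
Lemma probability_white_next n k : (0 < white u + blue u)%N ->
  P ([set t | white_draws D n t = k] `&` [set t | D n t = true]) =
  (((white u + k)%:R / (white u + blue u + n)%:R)%:E *
    P [set t | white_draws D n t = k])%E.
Proof.
move=> u0.
rewrite white_draws_event.
apply: (probability_history_eventI (p := fun s => pred1 k (count_mem true s))).
- exact: measurable_draw.
- by rewrite divr_ge0.
move=> s /eqP sk; set H := [set t | draws D n t = s].
have mH : measurable H by exact: measurable_history.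
have mHD : measurable (H `&` [set t | D n t = true]).
  by apply: measurableI => //; exact: measurable_draw.
have [PH0|PH0] := eqVneq (P H) 0%E.
  apply/eqP; rewrite PH0 mule0 -measure_le0 -PH0.
  by apply: le_measure; rewrite ?inE//; exact: subIsetl.
have fH : P H \is a fin_num by exact: fin_num_measure.
have fHD : P (H `&` [set t | D n t = true]) \is a fin_num by exact: fin_num_measure.
have := urnD PH0; rewrite -/H contents_count /= sk /cond_prob.
have -> : (white u + k + (blue u + count_mem false s) = white u + blue u + n)%N.
  by rewrite -[in RHS](size_tuple s) -count_true_false; lia.
move=> <-; rewrite -[X in (_ * X)%E](fineK fH) -EFinM divfK ?fine_eq0//.
by rewrite [in RHS]setIC fineK.
Qed.

(** The bound that drives transience.  Both colours must be present initially:
    at [k = 0] only the blue numerator [b + n] is left, and at [k = n + 1] only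
    the white one [w + n]; each is at most [m + n] because the other colour has
    a ball. *)
Lemma white_draws_ub m n k : (0 < white u)%N -> (0 < blue u)%N ->
  (white u + blue u)%N = m.+1 ->
  fine (P [set t | white_draws D n t = k]) <= m%:R / (m + n)%:R.
Proof.
move=> w0 b0 mE; pose q i j := fine (P [set t | white_draws D i t = j]).
have m0 : (0 < m)%N by lia.
have q0 i j : 0 <= q i j by exact/fine_ge0/measure_ge0.
have mq := measurable_white_draws D; have md := measurable_draw D.
have fq i j : P [set t | white_draws D i t = j] \is a fin_num.
  by apply: fin_num_measure; exact: mq.
(* Beyond [j = i] the factor in [qN] may be negative, but its weight is 0. *)
have qgt i j : (i < j)%N -> q i j = 0.
  move=> ij; rewrite /q (_ : [set _ | _] = set0) ?measure0//.
  by apply/seteqP; split=> // t /= E; have := white_draws_leq D i t; lia.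
have qD i j : fine (P ([set t | white_draws D i t = j] `&` [set t | D i t = true]))
    = q i j * ((white u + j)%:R / (m.+1 + i)%:R).
  rewrite probability_white_next ?mE// -(fineK (fq i j)) -EFinM /=.
  by rewrite mulrC.
have qN i j : fine (P ([set t | white_draws D i t = j] `\` [set t | D i t = true]))
    = q i j * (1 - (white u + j)%:R / (m.+1 + i)%:R).
  rewrite mulrBr mulr1 -qD measureD//; last by rewrite ltey_eq fq.
  by rewrite fineB// fin_num_measure//; exact: measurableI.
have qS i j : q i.+1 j.+1 =
    q i j * ((white u + j)%:R / (m.+1 + i)%:R)
    + q i j.+1 * (1 - (white u + j.+1)%:R / (m.+1 + i)%:R).
  rewrite -qD -qN -fineD ?fin_num_measure//; [|exact: measurableI|exact: measurableD].
  rewrite -measureU.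
  - congr (fine (P _)); apply/seteqP; split=> t;
      rewrite /setU /setD /setI /mkset white_drawsS.
      by case: (D i t) => /=; [left|right]; split=> //; lia.
    by move=> [[-> ->]|[-> /negP/negbTE ->]]; lia.
  - exact: measurableI.
  - exact: measurableD.
  by apply/seteqP; split=> // t /= [[-> _] []]; lia.
have qS0 i : q i.+1 0%N = q i 0%N * (1 - (white u)%:R / (m.+1 + i)%:R).
  have := qN i 0%N; rewrite addn0 => <-; congr (fine (P _)).
  apply/seteqP; split=> t; rewrite /setU /setD /setI /mkset white_drawsS.
    by case: (D i t) => /=; [|split=> //]; lia.
  by move=> [-> /negP/negbTE ->].
rewrite -/(q n k); elim: n k => [|n IHn] k.
  rewrite addn0 divff ?pnatr_eq0 ?gtn_eqF// -lee_fin fineK ?fq//.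
  by apply: probability_le1; exact: mq.
have mn0 : 0 < (m + n)%:R :> R by rewrite ltr0n; lia.
have mn1 : 0 < (m.+1 + n)%:R :> R by rewrite ltr0n; lia.
have mnE : (m.+1 + n)%:R = (m + n)%:R + 1 :> R by rewrite addSn -natr1.
(* An average of two values below [m / (m + n)], with weights adding up to at
   most [(m + n) / (m + n + 1)]. *)
have step (x y a c : R) : x <= m%:R / (m + n)%:R -> y <= m%:R / (m + n)%:R ->
    0 <= a -> 0 <= c -> a + c <= (m + n)%:R ->
    x * (a / (m.+1 + n)%:R) + y * (c / (m.+1 + n)%:R) <= m%:R / (m + n.+1)%:R.
  move=> xC yC a0 c0 ac; rewrite addnS -addSn !mulrA -mulrDl ler_pM2r ?invr_gt0//.
  apply: (@le_trans _ _ (m%:R / (m + n)%:R * (a + c))).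
    by rewrite mulrDr lerD// ler_wpM2r.
  by rewrite mulrAC ler_pdivrMr// ler_wpM2l.
have complE (e : R) : 1 - e / (m.+1 + n)%:R =
    ((m.+1 + n)%:R - e) / (m.+1 + n)%:R.
  by rewrite mulrBl divff// gt_eqF.
have natD : (white u)%:R + (blue u)%:R = m%:R + 1 :> R.
  by rewrite -natrD mE -natr1.
have w1 : 1 <= (white u)%:R :> R by rewrite ler1n.
have b1 : 1 <= (blue u)%:R :> R by rewrite ler1n.
case: k => [|k].
  (* The term of a white draw is absent: fill it with 0. *)
  rewrite qS0 complE -[leLHS]add0r -(mul0r (0 / (m.+1 + n)%:R)).
  by apply: step => //; rewrite ?mnE ?natrD; have : 0 <= n%:R :> R by []; lra.
rewrite qS complE; case: (leqP k n) => kn; last first.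
  by rewrite !qgt ?mul0r ?addr0 ?divr_ge0//; lia.
have : k%:R <= n%:R :> R by rewrite ler_nat.
have : 0 <= k%:R :> R by [].
by move=> k0 kn1; apply: step => //; rewrite ?mnE ?natrD -?natr1; lra.
Qed.

End UrnBound.

(** * Return probabilities of the one-dimensional walk *)

Section Walk.
Context {dT : measure_display} {T : measurableType dT} {R : realType}.
Variables (P : probability T R) (D : nat -> {RV P >-> bool}).

Lemma walk_white n z t :
  walk D n t = z -> white_draws D n t = `|((n%:Z + z) %/ 2)%Z|%N.
Proof.
rewrite /walk /blue_draws /white_draws.
have := count_true_false (draws D n t); rewrite size_mkseq.
by move: (count_mem _ _) (count_mem _ _) => x y; lia.
Qed.

Lemma measurable_walk n z : measurable [set t | walk D n t = z].
Proof.
rewrite (_ : [set _ | _] = [set t | (fun s => (count_mem true s)%:Z -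
    (count_mem false s)%:Z == z) (draws D n t)]).
  exact: (measurable_history_event D n
    (fun s => (count_mem true s)%:Z - (count_mem false s)%:Z == z)).
by apply/seteqP; split=> t /= /eqP.
Qed.

(** The position determines the number of white draws, so [white_draws_ub]
    applies; its [m] is at least 1, whence the denominator [n.+1]. *)
Lemma walk_ub u n z : polya_draws u D -> (0 < white u)%N -> (0 < blue u)%N ->
  fine (P [set t | walk D n t = z]) <= (white u + blue u)%:R / n.+1%:R.
Proof.
move=> urnD w0 b0; set m := (white u + blue u)%N.
apply: (@le_trans _ _ (m.-1%:R / (m.-1 + n)%:R)).
  have mE : (white u + blue u)%N = m.-1.+1 by rewrite /m; lia.
  apply: le_trans (white_draws_ub urnD n `|((n%:Z + z) %/ 2)%Z|%N w0 b0 mE).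
  have mW := measurable_white_draws D; have mX := measurable_walk.
  apply: fine_le; [exact: fin_num_measure|exact: fin_num_measure|].
  by apply: le_measure; rewrite ?inE// => t /walk_white.
by apply: ler_pM => //; rewrite ?invr_ge0// ?lef_pV2 ?posrE ?ltr0n ?ler_nat; lia.
Qed.

End Walk.

(** * Borel-Cantelli with inverse squares *)

(** This is the comparison of [1 / (n + 1)^2] with the telescoping
    [2 / (n + 1) - 2 / (n + 2)]; the factor 2 makes it hold from [n = 0] on. *)
Lemma sum_inv_sq_ub (R : realFieldType) N :
  \sum_(0 <= n < N) (n.+1%:R ^+ 2)^-1 <= 2 - 2 / N.+1%:R :> R.
Proof.
elim: N => [|N IHN]; first by rewrite big_nil divr1 subrr.
rewrite big_nat_recr//=; apply: (le_trans (lerD IHN (lexx _))).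
rewrite -(natr1 N.+1); set x : R := N.+1%:R.
have x1 : 1 <= x by rewrite ler1n.
rewrite -subr_ge0.
have -> : 2 - 2 / (x + 1) - (2 - 2 / x + (x ^+ 2)^-1) = (x - 1) / (x ^+ 2 * (x + 1)).
  by field; rewrite !lt0r_neq0//; lra.
by rewrite divr_ge0 ?mulr_ge0 ?exprn_ge0//; lra.
Qed.

Lemma transient_inv_sq {dT : measure_display} {T : measurableType dT} {R : realType}
  (P : probability T R) (S : Type) (X : nat -> T -> S) (x : S) (C : R) :
  (forall n, measurable (X n @^-1` [set x])) ->
  (forall n, (P (X n @^-1` [set x]) <= (C / n.+1%:R ^+ 2)%:E)%E) ->
  transient P X x.
Proof.
move=> mX PX; rewrite /transient /recurrent (@lim_sup_set_cvg0 _ _ _ P)//.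
  by move=> /eqP; rewrite eqe eq_sym oner_eq0.
have C0 : 0 <= C.
  by have := le_trans (measure_ge0 _ _) (PX 0%N); rewrite lee_fin expr1n divr1.
apply: (@le_lt_trans _ _ (C * 2)%:E); last exact: ltry.
apply: lime_le; first exact: is_cvg_nneseries.
apply: nearW => N; apply: (le_trans (lee_sum _ (fun n _ => PX n))).
rewrite sumEFin lee_fin -mulr_sumr ler_wpM2l//.
by apply: le_trans (sum_inv_sq_ub _ N) _; rewrite gerBl divr_ge0.
Qed.

(** * Transience *)

Local Close Scope classical_set_scope.

Theorem theorem3p1 (R : realType) (dT : measure_display)
    (T : measurableType dT) (P : probability T R)
    (d : nat) (hd : (2 <= d)%N)
    (w b : 'I_d -> nat)
    (hw : forall i : 'I_d, (1 <= w i)%N) (hb : forall i : 'I_d, (1 <= b i)%N)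
    (D : 'I_d -> nat -> {RV P >-> bool})
    (hurn : forall i : 'I_d, polya_draws (Urn (w i) (b i)) (D i))
    (hindep : independent_processes P (fun i : 'I_d => walk (D i))) :
  transient P (walk_vec (fun i : 'I_d => (D i : nat -> T -> bool)))
    (0 : 'rV[int]_d).
Proof.
pose i0 := Ordinal (ltnW hd); pose i1 := Ordinal hd.
pose E n (i : 'I_d) : set T := [set t | walk (D i) n t = 0]%classic.
have mE n i : measurable (E n i) by exact: measurable_walk.
have vecE n : (walk_vec (fun i => (D i : nat -> T -> bool)) n @^-1` [set 0] =
    \bigcap_(i in setT) E n i)%classic.
  apply/seteqP; split=> t /=.
    by move=> /rowP H i _; have := H i; rewrite !mxE.
  by move=> H; apply/rowP => i; rewrite !mxE; exact: H.
pose C i : R := (w i + b i)%:R.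
apply: (@transient_inv_sq _ _ _ _ _ _ _ (C i0 * C i1)) => n; rewrite vecE.
  by apply: fin_bigcap_measurable.
(* Vanishing of the first two coordinates is already rare enough. *)
have PE : P (\bigcap_(i in [set` [set i0; i1]%SET]) E n i)%classic =
    (fine (P (E n i0)) * fine (P (E n i1)))%:E.
  rewrite hindep; last by move=> i _; apply: sub_sigma_algebra; exists n, 0.
  by rewrite big_setU1 ?big_set1// inE.
apply: (@le_trans _ _ (P (\bigcap_(i in [set` [set i0; i1]%SET]) E n i)%classic)).
  apply: le_measure; rewrite ?inE; [| |by move=> t H i _; exact: H].
    by apply: fin_bigcap_measurable.
  by apply: fin_bigcap_measurable; first exact: finite_finset.
rewrite PE lee_fin expr2 invfM mulrACA.
by apply: ler_pM; rewrite ?fine_ge0//; exact: (walk_ub n 0 (hurn _) (hw _) (hb _)).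
Qed.
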